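(* Let $V$ be a unital Jordan superalgebra over a field $\mathbb{K}$ of characteristic different from $2$ and $3$. Then there are isomorphisms of Lie superalgebras (1) $\mathfrak{str}(V)\cong \mathrm{Der}(V,V)$, (2) $\mathfrak{istr}(V)\cong \mathrm{Inn}(V,V)$.
   Context: $\mathbb{K}$ is a field of characteristic $\neq 2,3$. Super vector spaces $V=V_{\bar 0}\oplus V_{\bar 1}$ are not assumed finite dimensional; $|x|\in\mathbb{Z}/2\mathbb{Z}$ is the parity of a homogeneous $x$; formulas with signs are for homogeneous elements and extended linearly; $[A,B]=AB-(-1)^{|A||B|}BA$ is the supercommutator on $\mathrm{End}(V)$, and $\mathfrak{gl}(V)$ is $\mathrm{End}(V)$ with this bracket. A Jordan superalgebra is a super vector space $V$ with a bilinear product satisfying $V_iV_j\subset V_{i+j}$, $xy=(-1)^{|x||y|}yx$, and $(-1)^{|x||z|}[L_x,L_{yz}]+(-1)^{|y||x|}[L_y,L_{zx}]+(-1)^{|z||y|}[L_z,L_{xy}]=0$, where $L_x(y)=xy$. It is unital if there is $e\in V$ with $ex=x=xe$ for all $x$. $\mathrm{Der}(V)$ is the space of derivations, i.e. (spanned by homogeneous) $D\in\mathrm{End}(V)$ with $D(xy)=D(x)y+(-1)^{|x||D|}xD(y)$; $\mathrm{Inn}(V)\subset\mathrm{Der}(V)$ is the linear span of the operators $[L_x,L_y]$. The structure algebra is $\mathfrak{str}(V)=\{L_x\mid x\in V\}+\mathrm{Der}(V)\subset\mathfrak{gl}(V)$ and the inner structure algebra is $\mathfrak{istr}(V)=\{L_x\mid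 x\in V\}+\mathrm{Inn}(V)\subset\mathfrak{gl}(V)$; both are Lie subsuperalgebras. Set $D_{x,y}=2L_{xy}+2[L_x,L_y]$ and $\{x,y,z\}=D_{x,y}z$. $\mathrm{Der}(V,V)$ is the Lie subsuperalgebra of $\mathfrak{gl}(V)\oplus\mathfrak{gl}(V)$ spanned by pairs $(D^+,D^-)$, with $D^+,D^-$ homogeneous of the same parity, such that for $\sigma\in\{+,-\}$ and all homogeneous $x,y,z$: $D^\sigma(\{x,y,z\})=\{D^\sigma(x),y,z\}+(-1)^{|x||D^{-\sigma}|}\{x,D^{-\sigma}(y),z\}+(-1)^{(|x|+|y|)|D^\sigma|}\{x,y,D^\sigma(z)\}$. $\mathrm{Inn}(V,V)\subset\mathrm{Der}(V,V)$ is the span of the elements $(D_{x,y},-(-1)^{|x||y|}D_{y,x})$, $x,y\in V$. *)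

(* Defs.v *)
From HB Require Import structures.
From mathcomp Require Import all_boot all_algebra.
From mathcomp Require Import boolp classical_sets.

Set Implicit Arguments.
Unset Strict Implicit.
Unset Printing Implicit Defensive.

Import GRing.Theory.
Local Open Scope ring_scope.
Local Open Scope classical_set_scope.

(* A decision procedure for identities in abelian groups, used in the proofs
   that the subspaces defined below are Lie subsuperalgebras. *)

Module ZmodTac.
Inductive zexpr := ZVar of nat | ZAdd of zexpr & zexpr | ZOpp of zexpr | ZZero.

Fixpoint zeval (V : zmodType) (env : seq V) e : V :=
  match e with
  | ZVar n => nth 0 env n
  | ZAdd e1 e2 => zeval env e1 + zeval env e2
  | ZOpp e1 => - zeval env e1
  | ZZero => 0
  end.

Fixpoint zcoef e (i : nat) : int :=
  match e with
  | ZVar n => (n == i)%:Z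
  | ZAdd e1 e2 => zcoef e1 i + zcoef e2 i
  | ZOpp e1 => - zcoef e1 i
  | ZZero => 0
  end.

Lemma zevalE (V : zmodType) (env : seq V) e :
  zeval env e = \sum_(i < size env) env`_i *~ zcoef e i.
Proof.
elim: e => [n|e1 IH1 e2 IH2|e1 IH1|] /=.
- have [lt_n|le_n] := ltnP n (size env); last first.
    rewrite nth_default // big1 // => i _.
    by rewrite (gtn_eqF (leq_trans (ltn_ord i) le_n)).
  rewrite (bigD1 (Ordinal lt_n)) //= eqxx big1 ?addr0 // => i.
  by rewrite -val_eqE /= eq_sym => /negPf ->.
- by rewrite IH1 IH2 -big_split; apply: eq_bigr => i _; rewrite mulrzDr.
- by rewrite IH1 -sumrN; apply: eq_bigr => i _; rewrite mulrNz.
- by rewrite big1.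
Qed.

Lemma zeval_eq (V : zmodType) (env : seq V) e1 e2 :
  all (fun i => zcoef e1 i == zcoef e2 i) (iota 0 (size env)) ->
  zeval env e1 = zeval env e2.
Proof.
move=> /allP eqc; rewrite !zevalE; apply: eq_bigr => i _; congr (_ *~ _).
by apply/eqP/eqc; rewrite mem_iota add0n ltn_ord.
Qed.

(* Atoms are compared up to conversion, as canonical instances may differ. *)
Ltac zmem x env :=
  match env with
  | nil => constr:(false)
  | ?y :: _ => let _ := match goal with _ => unify x y end in constr:(true)
  | _ :: ?env' => zmem x env'
  end.
Ltac zindex x env :=
  match env with
  | ?y :: _ => let _ := match goal with _ => unify x y end in constr:(0%N)
  | _ :: ?env' => let n := zindex x env' in constr:(S n)
  end.
Ltac zenv t env :=
  match t with
  | @GRing.zero _ => env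
  | @GRing.add _ ?a ?b => let env := zenv a env in zenv b env
  | @GRing.opp _ ?a => zenv a env
  | _ => match zmem t env with
         | true => env
         | false => constr:(t :: env)
         end
  end.
Ltac zreify t env :=
  match t with
  | @GRing.zero _ => constr:(ZZero)
  | @GRing.add _ ?a ?b =>
      let a := zreify a env in let b := zreify b env in constr:(ZAdd a b)
  | @GRing.opp _ ?a => let a := zreify a env in constr:(ZOpp a)
  | _ => let n := zindex t env in constr:(ZVar n)
  end.
End ZmodTac.

Ltac zmodule :=
  match goal with
  | |- @eq ?T ?a ?b =>
    let env := ZmodTac.zenv a (@nil T) in
    let env := ZmodTac.zenv b env in
    let e1 := ZmodTac.zreify a env in
    let e2 := ZmodTac.zreify b env in
    exact (@ZmodTac.zeval_eq _ env e1 e2 (erefl true))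
  end.

(* Parities are booleans, [false] for even and [true] for odd, so that [i (+) j]
   is the sum in Z/2 and [i && j] the product.  A grading V = V_0 (+) V_1 is
   given by the two projections [spart i] onto V_i along the other summand. *)
HB.mixin Record isSuperSpace (K : fieldType) V of GRing.Lmodule K V := {
  spart : bool -> V -> V;
  spart_linear : forall i, linear (spart i);
  spartE : forall i j x, spart i (spart j x) = if i == j then spart i x else 0;
  spart_sum : forall x, spart false x + spart true x = x
}.

#[short(type="superSpaceType")]
HB.structure Definition SuperSpace (K : fieldType) :=
  {V of GRing.Lmodule K V & isSuperSpace K V}.

Section SuperSpaceTheory.
Variables (K : fieldType) (V : superSpaceType K).
Implicit Types x y : V.

Definition homog (i : bool) x := spart i x = x.

HB.instance Definition _ i :=
  GRing.isLinear.Build K V V *:%R (spart i) (@spart_linear K V i).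

Lemma homog_part i x : homog i (spart i x).
Proof. by rewrite /homog spartE eqxx. Qed.

Lemma homogD i x y : homog i x -> homog i y -> homog i (x + y).
Proof. by rewrite /homog linearD /= => -> ->. Qed.

Lemma homogZ i a x : homog i x -> homog i (a *: x).
Proof. by rewrite /homog linearZ /= => ->. Qed.

Lemma homogN i x : homog i x -> homog i (- x).
Proof. by rewrite /homog linearN /= => ->. Qed.

Lemma homog0 i : homog i (0 : V).
Proof. by rewrite /homog linear0. Qed.

Lemma homog_sum i (I : Type) (r : seq I) (P : pred I) (F : I -> V) :
  (forall k, P k -> homog i (F k)) -> homog i (\sum_(k <- r | P k) F k).
Proof. by move=> hF; apply: big_ind => //; [exact: homog0|exact: homogD]. Qed.

Lemma spart_homog i j x : homog i x -> spart j x = if j == i then x else 0.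
Proof. by move=> <-; rewrite spartE; case: eqP => // ->. Qed.

Lemma superP x : x = \sum_i spart i x.
Proof. by rewrite big_bool /= addrC spart_sum. Qed.
End SuperSpaceTheory.

(* The product [smul], not assumed to be associative, is the Jordan product in a
   Jordan superalgebra and the bracket in a Lie superalgebra. *)
HB.mixin Record isSuperAlgebra (K : fieldType) V of SuperSpace K V := {
  smul : V -> V -> V;
  smul_linearl : forall y, linear (smul^~ y);
  smul_linearr : forall x, linear (smul x);
  smul_homog : forall i j x y,
    homog i x -> homog j y -> homog (i (+) j) (smul x y)
}.

#[short(type="superAlgebraType")]
HB.structure Definition SuperAlgebra (K : fieldType) :=
  {V of SuperSpace K V & isSuperAlgebra K V}.

Section SuperAlgebraTheory.
Variables (K : fieldType) (V : superAlgebraType K).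

HB.instance Definition _ (x : V) :=
  GRing.isLinear.Build K V V *:%R (smul x) (@smul_linearr K V x).

Lemma smulDl (x y z : V) : smul (x + y) z = smul x z + smul y z.
Proof. by have /(_ 1 x y) := smul_linearl z; rewrite /= !scale1r. Qed.
Lemma smul0l (z : V) : smul 0 z = 0.
Proof. by apply: (addrI (smul 0 z)); rewrite -smulDl !addr0. Qed.
Lemma smulZl a (x z : V) : smul (a *: x) z = a *: smul x z.
Proof.
by have /(_ a x 0) := smul_linearl z; rewrite /= !addr0 smul0l addr0.
Qed.
Lemma smulNl (x z : V) : smul (- x) z = - smul x z.
Proof. by rewrite -scaleN1r smulZl scaleN1r. Qed.
Lemma smulDr (x y z : V) : smul z (x + y) = smul z x + smul z y.
Proof. exact: linearD. Qed.
Lemma smul0r (z : V) : smul z 0 = 0.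
Proof. exact: linear0. Qed.
Lemma smulZr a (x z : V) : smul z (a *: x) = a *: smul z x.
Proof. exact: linearZ. Qed.
Lemma smulNr (x z : V) : smul z (- x) = - smul z x.
Proof. exact: linearN. Qed.
Lemma smul_suml (I : Type) (r : seq I) (P : pred I) (F : I -> V) z :
  smul (\sum_(k <- r | P k) F k) z = \sum_(k <- r | P k) smul (F k) z.
Proof. by apply: (big_morph (smul^~ z)) => [x y|]; rewrite ?smulDl ?smul0l. Qed.
Lemma smul_sumr (I : Type) (r : seq I) (P : pred I) (F : I -> V) z :
  smul z (\sum_(k <- r | P k) F k) = \sum_(k <- r | P k) smul z (F k).
Proof. exact: linear_sum. Qed.
End SuperAlgebraTheory.

HB.mixin Record isLieSuperalgebra (K : fieldType) L of SuperAlgebra K L := {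
  lieC : forall i j (x y : L), homog i x -> homog j y ->
    smul x y = - ((-1) ^+ (i && j) *: smul y x);
  lieJ : forall i j (x y z : L), homog i x -> homog j y ->
    smul x (smul y z) =
    smul (smul x y) z + (-1) ^+ (i && j) *: smul y (smul x z)
}.

#[short(type="lieSuperalgebraType")]
HB.structure Definition LieSuperalgebra (K : fieldType) :=
  {L of SuperAlgebra K L & isLieSuperalgebra K L}.

(* Isomorphisms of Lie superalgebras are required to be even. *)
Definition lie_isomorphic (K : fieldType) (L M : lieSuperalgebraType K) :=
  exists f : {linear L -> M},
    [/\ bijective f,
        forall i x, homog i x -> homog i (f x)
      & forall x y, f (smul x y) = smul (f x) (f y)].

Section DirectSum.
Variables (K : fieldType).

Section Space.
Variables (L M : superSpaceType K).
Definition prod_part i (x : L * M) : L * M := (spart i x.1, spart i x.2).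
Fact prod_part_linear i : linear (prod_part i).
Proof. by move=> a x y; congr pair; rewrite /= linearP. Qed.
Fact prod_partE i j x :
  prod_part i (prod_part j x) = if i == j then prod_part i x else 0.
Proof. by rewrite /prod_part /= !spartE; case: eqP. Qed.
Fact prod_part_sum x : prod_part false x + prod_part true x = x.
Proof. by case: x => x y; congr pair; rewrite /= spart_sum. Qed.
HB.instance Definition _ := isSuperSpace.Build K (L * M)%type
  prod_part_linear prod_partE prod_part_sum.
Lemma homog_prod i (x : L * M) : homog i x <-> homog i x.1 /\ homog i x.2.
Proof.
case: x => x y; split=> [h|[h1 h2]]; last exact: (congr2 pair h1 h2).
by split; [exact: (congr1 fst h)|exact: (congr1 snd h)].
Qed.
End Space.

Section Algebra.
Variables (L M : superAlgebraType K).
Definition prod_smul (x y : L * M) : L * M := (smul x.1 y.1, smul x.2 y.2).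
Fact prod_smul_linearl y : linear (prod_smul^~ y).
Proof. by move=> a x z; congr pair; rewrite /= smulDl smulZl. Qed.
Fact prod_smul_linearr x : linear (prod_smul x).
Proof. by move=> a z y; congr pair; rewrite /= linearP. Qed.
Fact prod_smul_homog i j x y :
  homog i x -> homog j y -> homog (i (+) j) (prod_smul x y).
Proof.
move=> /homog_prod[hx1 hx2] /homog_prod[hy1 hy2].
by apply/homog_prod; split; apply: smul_homog.
Qed.
HB.instance Definition _ := isSuperAlgebra.Build K (L * M)%type
  prod_smul_linearl prod_smul_linearr prod_smul_homog.
End Algebra.

Section Lie.
Variables (L M : lieSuperalgebraType K).
Fact prod_lieC i j (x y : L * M) : homog i x -> homog j y ->
  smul x y = - ((-1) ^+ (i && j) *: smul y x).
Proof.
move=> /homog_prod[hx1 hx2] /homog_prod[hy1 hy2].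
by congr pair; apply: lieC.
Qed.
Fact prod_lieJ i j (x y z : L * M) : homog i x -> homog j y ->
  smul x (smul y z) = smul (smul x y) z + (-1) ^+ (i && j) *: smul y (smul x z).
Proof.
move=> /homog_prod[hx1 hx2] /homog_prod[hy1 hy2].
by congr pair; apply: lieJ.
Qed.
HB.instance Definition _ := isLieSuperalgebra.Build K (L * M)%type
  prod_lieC prod_lieJ.
End Lie.
End DirectSum.

(* [gl V] is the space of all linear endomorphisms of V, of which the even
   (odd) ones are those that preserve (exchange) V_0 and V_1. *)
Definition gl (K : fieldType) (V : superSpaceType K) := {linear V -> V}.

Section GeneralLinear.
Variables (K : fieldType) (V : superSpaceType K).
Implicit Types A B C : gl V.

HB.instance Definition _ := gen_eqMixin (gl V).
HB.instance Definition _ := gen_choiceMixin (gl V).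

Lemma glP A B : (forall x, A x = B x) -> A = B.
Proof.
case: A B => [f [[fl1] [fl2]]] [g [[gl1] [gl2]]] /= /funext eq_fg.
case: g / eq_fg gl1 gl2 => gl1 gl2.
by rewrite (Prop_irrelevance fl1 gl1) (Prop_irrelevance fl2 gl2).
Qed.

Definition gl_zero : gl V := \0%R.
Definition gl_add A B : gl V := A \+ B.
Definition gl_opp A : gl V := \- A.
Definition gl_scale (a : K) A : gl V := a \*: A.
Definition gl_comp A B : gl V := A \o B.

Fact gl_addA : associative gl_add.
Proof. by move=> A B C; apply: glP => x; rewrite /= addrA. Qed.
Fact gl_addC : commutative gl_add.
Proof. by move=> A B; apply: glP => x; rewrite /= addrC. Qed.
Fact gl_add0 : left_id gl_zero gl_add.
Proof. by move=> A; apply: glP => x; rewrite /= add0r. Qed.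
Fact gl_addN : left_inverse gl_zero gl_opp gl_add.
Proof. by move=> A; apply: glP => x; rewrite /= addNr. Qed.
HB.instance Definition _ := GRing.isZmodule.Build (gl V)
  gl_addA gl_addC gl_add0 gl_addN.

Fact gl_scaleA a b A : gl_scale a (gl_scale b A) = gl_scale (a * b) A.
Proof. by apply: glP => x; rewrite /= scalerA. Qed.
Fact gl_scale1 : left_id 1 gl_scale.
Proof. by move=> A; apply: glP => x; rewrite /= scale1r. Qed.
Fact gl_scaleDr : right_distributive gl_scale +%R.
Proof. by move=> a A B; apply: glP => x; rewrite /= scalerDr. Qed.
Fact gl_scaleDl A : {morph gl_scale^~ A : a b / a + b}.
Proof. by move=> a b; apply: glP => x; rewrite /= scalerDl. Qed.
HB.instance Definition _ := GRing.Zmodule_isLmodule.Build K (gl V)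
  gl_scaleA gl_scale1 gl_scaleDr gl_scaleDl.

Lemma gl0E x : (0 : gl V) x = 0. Proof. by []. Qed.
Lemma glDE A B x : (A + B) x = A x + B x. Proof. by []. Qed.
Lemma glNE A x : (- A) x = - A x. Proof. by []. Qed.
Lemma glZE a A x : (a *: A) x = a *: A x. Proof. by []. Qed.
Lemma gl_appD A x y : A (x + y) = A x + A y. Proof. exact: linearD. Qed.
Lemma gl_appN A x : A (- x) = - A x. Proof. exact: linearN. Qed.
Lemma gl_appZ a A x : A (a *: x) = a *: A x. Proof. exact: linearZ. Qed.
Lemma gl_compE A B x : gl_comp A B x = A (B x). Proof. by []. Qed.
Lemma gl_sumE (I : Type) (r : seq I) (P : pred I) (F : I -> gl V) x :
  (\sum_(k <- r | P k) F k) x = \sum_(k <- r | P k) F k x.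
Proof. by apply: (big_morph (fun A : gl V => A x)). Qed.

Definition gl_part (i : bool) A : gl V :=
  \sum_j gl_comp (spart (i (+) j)) (gl_comp A (spart j)).

Lemma gl_partE i A x : gl_part i A x =
  \sum_j spart (i (+) j) (A (spart j x)).
Proof. exact: gl_sumE. Qed.

Fact gl_part_linear i : linear (gl_part i).
Proof.
move=> a A B; apply: glP => x; rewrite glDE glZE !gl_partE scaler_sumr.
by rewrite -big_split; apply: eq_bigr => j _; rewrite glDE glZE linearP.
Qed.

Fact gl_part_part i j A :
  gl_part i (gl_part j A) = if i == j then gl_part i A else 0.
Proof.
apply: glP => x; rewrite gl_partE.
under eq_bigr => k _.
  rewrite gl_partE (bigD1 k) //= big1 ?addr0; last first.
    by move=> l /negPf lk; rewrite spartE lk !linear0.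
  rewrite !spartE eqxx.
  over.
rewrite /=; case: eqP => [->|/eqP ne_ij].
  by rewrite gl_partE; apply: eq_bigr => k _; rewrite eqxx.
rewrite big1 // => k _; case: eqP => // /addIb eq_ij.
by rewrite eq_ij eqxx in ne_ij.
Qed.

Fact gl_part_sum A : gl_part false A + gl_part true A = A.
Proof.
apply: glP => x; rewrite glDE !gl_partE !big_bool /=.
rewrite [in RHS](superP x) big_bool linearD /=.
rewrite -[A (spart true x) in RHS]spart_sum -[A (spart false x) in RHS]spart_sum.
by zmodule.
Qed.

HB.instance Definition _ := isSuperSpace.Build K (gl V)
  gl_part_linear gl_part_part gl_part_sum.

Lemma homog_glP i A :
  homog i A <-> forall j x, homog j x -> homog (i (+) j) (A x).
Proof.
split=> [hA j x hx|hA]; last first.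
  apply: glP => x; rewrite gl_partE [in RHS](superP x) linear_sum.
  by apply: eq_bigr => j _; apply: hA; apply: homog_part.
rewrite -hA [spart _ _]/(gl_part i A) gl_partE (bigD1 j) //= big1 ?addr0.
  exact: homog_part.
by move=> l /negPf lj; rewrite (spart_homog _ hx) lj !linear0.
Qed.

Lemma homog_comp i j A B :
  homog i A -> homog j B -> homog (i (+) j) (gl_comp A B).
Proof.
move=> /homog_glP hA /homog_glP hB; apply/homog_glP => k x hx.
by rewrite -addbA; apply/hA/hB.
Qed.

(* The bilinear extension of AB - (-1)^(|A||B|) BA. *)
Definition scomm A B : gl V := \sum_i \sum_j
  (gl_comp (spart i A) (spart j B)
   - (-1) ^+ (i && j) *: gl_comp (spart j B) (spart i A)).

Lemma scomm_homog i j A B : homog i A -> homog j B ->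
  scomm A B = gl_comp A B - (-1) ^+ (i && j) *: gl_comp B A.
Proof.
move=> hA hB; rewrite /scomm (bigD1 i) //= (bigD1 j) //= !(spart_homog _ hA).
have c0l C : gl_comp 0 C = 0 by apply: glP.
have c0r C : gl_comp C 0 = 0 by apply: glP => x; rewrite gl_compE linear0.
rewrite !(spart_homog _ hB) !eqxx big1 ?addr0 => [|l /negPf lj]; last first.
  by rewrite (spart_homog _ hB) lj c0l c0r scaler0 subr0.
rewrite big1 ?addr0 // => l /negPf li; rewrite big1 // => m _.
by rewrite (spart_homog _ hA) li c0l c0r scaler0 subr0.
Qed.

Fact scomm_linearl B : linear (scomm^~ B).
Proof.
move=> a A1 A2; rewrite /scomm scaler_sumr -big_split; apply: eq_bigr => i _.
rewrite scaler_sumr -big_split; apply: eq_bigr => j _.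
apply: glP => x; rewrite linearP !(glDE, glNE, glZE, gl_compE) linearP /=.
rewrite ![_ *: (_ + _)]scalerDr !scalerN !scalerA [_ * a]mulrC.
by zmodule.
Qed.

Fact scomm_linearr A : linear (scomm A).
Proof.
move=> a B1 B2; rewrite /scomm scaler_sumr -big_split; apply: eq_bigr => i _.
rewrite scaler_sumr -big_split; apply: eq_bigr => j _.
apply: glP => x; rewrite linearP !(glDE, glNE, glZE, gl_compE) linearP /=.
rewrite ![_ *: (_ + _)]scalerDr !scalerN !scalerA [_ * a]mulrC.
by zmodule.
Qed.

Fact scomm_homog_mul i j A B :
  homog i A -> homog j B -> homog (i (+) j) (scomm A B).
Proof.
move=> hA hB; rewrite (scomm_homog hA hB).
apply: homogD; first exact: homog_comp.
by apply/homogN/homogZ; rewrite addbC; apply: homog_comp.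
Qed.

HB.instance Definition _ := isSuperAlgebra.Build K (gl V)
  scomm_linearl scomm_linearr scomm_homog_mul.

Lemma gl_smulE A B : smul A B = scomm A B. Proof. by []. Qed.

Fact gl_lieC i j A B : homog i A -> homog j B ->
  smul A B = - ((-1) ^+ (i && j) *: smul B A).
Proof.
move=> hA hB; rewrite !gl_smulE (scomm_homog hA hB) (scomm_homog hB hA).
rewrite [j && i]andbC scalerBr scalerA -signr_addb addbb scale1r.
by rewrite opprB.
Qed.

Fact gl_lieJ i j A B C : homog i A -> homog j B ->
  smul A (smul B C) = smul (smul A B) C + (-1) ^+ (i && j) *: smul B (smul A C).
Proof.
move=> hA hB; suff jac k D : homog k D -> smul A (smul B D) =
    smul (smul A B) D + (-1) ^+ (i && j) *: smul B (smul A D).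
  rewrite -(spart_sum C) !smulDr scalerDr.
  rewrite (jac _ _ (homog_part false C)) (jac _ _ (homog_part true C)).
  by zmodule.
move=> hD; rewrite !gl_smulE.
rewrite (scomm_homog hA (scomm_homog_mul hB hD)).
rewrite (scomm_homog (scomm_homog_mul hA hB) hD).
rewrite (scomm_homog hB (scomm_homog_mul hA hD)).
rewrite (scomm_homog hB hD) (scomm_homog hA hD) (scomm_homog hA hB).
apply: glP => x; rewrite !(glDE, glNE, glZE, gl_compE) !(linearB, linearZ) /=.
case: i j k {hA hB hD} => [] [] [] /=;
  rewrite ?expr0 ?expr1 ?scale1r ?scaleN1r ?opprK; zmodule.
Qed.

HB.instance Definition _ := isLieSuperalgebra.Build K (gl V) gl_lieC gl_lieJ.

End GeneralLinear.

Definition lspan (K : fieldType) (V : lmodType K) (G : set V) : set V :=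
  [set v | exists n (c : 'I_n -> K) (g : 'I_n -> V),
    (forall i, G (g i)) /\ v = \sum_i c i *: g i].

Section Span.
Variables (K : fieldType).
Implicit Types V W : lmodType K.

Lemma lspan_gen V (G : set V) v : G v -> lspan G v.
Proof.
by move=> Gv; exists 1%N, (fun=> 1), (fun=> v); rewrite big_ord1 scale1r.
Qed.

Lemma lspan0 V (G : set V) : lspan G 0.
Proof.
exists 0%N, (fun=> 0), (fun=> 0); rewrite big_ord0; split=> // i.
by case: i.
Qed.

Lemma lspanD V (G : set V) u v : lspan G u -> lspan G v -> lspan G (u + v).
Proof.
move=> [n [c [g [Gg ->]]]] [m [d [h [Gh ->]]]]; exists (n + m)%N.
exists (fun i => match split i with inl j => c j | inr j => d j end).
exists (fun i => match split i with inl j => g j | inr j => h j end).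
split=> [i|]; first by case: (split i).
rewrite big_split_ord; congr (_ + _); apply: eq_bigr => i _.
  by rewrite (unsplitK (inl i)).
by rewrite (unsplitK (inr i)).
Qed.

Lemma lspanZ V (G : set V) a v : lspan G v -> lspan G (a *: v).
Proof.
move=> [n [c [g [Gg ->]]]]; exists n, (fun i => a * c i), g; split=> //.
by rewrite scaler_sumr; apply: eq_bigr => i _; rewrite scalerA.
Qed.

Lemma lspan_ind V (G S : set V) :
  S 0 -> (forall a u v, S u -> S v -> S (a *: u + v)) -> G `<=` S ->
  lspan G `<=` S.
Proof.
move=> S0 Slin GS _ [n [c [g [Gg ->]]]].
elim/big_rec: _ => // i u _ Su; apply: Slin => //; exact: GS.
Qed.
End Span.

(* Lie subsuperalgebras: graded subspaces stable under the bracket. *)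
Record subLie (K : fieldType) (L : lieSuperalgebraType K) := SubLie {
  sl_set : set L;
  sl_0 : sl_set 0;
  sl_lin : forall a u v, sl_set u -> sl_set v -> sl_set (a *: u + v);
  sl_part : forall i u, sl_set u -> sl_set (spart i u);
  sl_smul : forall u v, sl_set u -> sl_set v -> sl_set (smul u v)
}.

Record sl_type (K : fieldType) (L : lieSuperalgebraType K) (S : subLie L) :=
  SlType { slval : L; slvalP : slval \in sl_set S }.

Section SubLie.
Variables (K : fieldType) (L : lieSuperalgebraType K) (S : subLie L).

HB.instance Definition _ := [isSub for @slval K L S].
HB.instance Definition _ := [Choice of sl_type S by <:].

Fact sl_submod : GRing.subsemimod_closed (fun x : L => x \in sl_set S).
Proof.
split; first split.
- exact/mem_set/sl_0.
- move=> u v /set_mem Su /set_mem Sv; apply/mem_set.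
  by rewrite -[u]scale1r; apply: sl_lin.
- move=> a u /set_mem Su; apply/mem_set.
  by rewrite -[_ *: _]addr0; apply: sl_lin => //; apply: sl_0.
Qed.
HB.instance Definition _ := GRing.SubChoice_isSubLmodule.Build K L
  (fun x : L => x \in sl_set S) (sl_type S) sl_submod.

Definition sl_spart i (x : sl_type S) : sl_type S :=
  SlType (mem_set (sl_part i (set_mem (slvalP x)))).
Fact sl_spart_linear i : linear (sl_spart i).
Proof. by move=> a x y; apply: val_inj; rewrite /= linearP. Qed.
Fact sl_spartE i j x :
  sl_spart i (sl_spart j x) = if i == j then sl_spart i x else 0.
Proof. by apply: val_inj; rewrite /= spartE; case: eqP. Qed.
Fact sl_spart_sum x : sl_spart false x + sl_spart true x = x.
Proof. by apply: val_inj; rewrite /= spart_sum. Qed.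
HB.instance Definition _ := isSuperSpace.Build K (sl_type S)
  sl_spart_linear sl_spartE sl_spart_sum.

Lemma homog_slval i (x : sl_type S) : homog i x <-> homog i (slval x).
Proof. by split=> [/(congr1 (@slval _ _ _))|h] //; apply: val_inj. Qed.

Definition sl_mul (x y : sl_type S) : sl_type S :=
  SlType (mem_set (sl_smul (set_mem (slvalP x)) (set_mem (slvalP y)))).
Fact sl_mul_linearl y : linear (sl_mul^~ y).
Proof. by move=> a x z; apply: val_inj; rewrite /= smulDl smulZl. Qed.
Fact sl_mul_linearr x : linear (sl_mul x).
Proof. by move=> a y z; apply: val_inj; rewrite /= smulDr smulZr. Qed.
Fact sl_mul_homog i j x y :
  homog i x -> homog j y -> homog (i (+) j) (sl_mul x y).
Proof. by move=> /homog_slval hx /homog_slval hy; apply/homog_slval/smul_homog. Qed.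
HB.instance Definition _ := isSuperAlgebra.Build K (sl_type S)
  sl_mul_linearl sl_mul_linearr sl_mul_homog.

Fact sl_lieC i j (x y : sl_type S) : homog i x -> homog j y ->
  smul x y = - ((-1) ^+ (i && j) *: smul y x).
Proof.
by move=> /homog_slval hx /homog_slval hy; apply/val_inj/lieC.
Qed.
Fact sl_lieJ i j (x y z : sl_type S) : homog i x -> homog j y ->
  smul x (smul y z) = smul (smul x y) z + (-1) ^+ (i && j) *: smul y (smul x z).
Proof.
by move=> /homog_slval hx /homog_slval hy; apply/val_inj/lieJ.
Qed.
HB.instance Definition _ := isLieSuperalgebra.Build K (sl_type S)
  sl_lieC sl_lieJ.
End SubLie.

Definition sl_lie (K : fieldType) (L : lieSuperalgebraType K) (S : subLie L) :
  lieSuperalgebraType K := sl_type S.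
Coercion sl_lie : subLie >-> lieSuperalgebraType.

(* A subspace spanned by homogeneous elements whose brackets lie in it. *)
Section SubLieGen.
Variables (K : fieldType) (L : lieSuperalgebraType K) (S G : set L).
Hypothesis S_lspan : S = lspan G.
Hypothesis G_homog : forall g, G g -> exists i, homog i g.
Hypothesis G_smul : forall g h, G g -> G h -> S (smul g h).

Let S0 : S 0. Proof. by rewrite S_lspan; apply: lspan0. Qed.
Let S_lin a u v : S u -> S v -> S (a *: u + v).
Proof. by rewrite S_lspan => Su Sv; apply: lspanD => //; apply: lspanZ. Qed.
Let S_part i u : S u -> S (spart i u).
Proof.
rewrite {1}S_lspan; move: u; apply: lspan_ind => /=.
- by rewrite linear0.
- by move=> a u v Su Sv; rewrite linearP; apply: S_lin.
move=> g Gg /=; have [j hg] := G_homog Gg; rewrite (spart_homog _ hg).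
by case: eqP => // _; rewrite S_lspan; apply: lspan_gen.
Qed.
Let S_smul u v : S u -> S v -> S (smul u v).
Proof.
rewrite {1 2}S_lspan => Su; move: v.
apply: (lspan_ind (S := [set v | S (smul u v)])) => /=.
- by rewrite smul0r.
- by move=> a v w Sv Sw; rewrite smulDr smulZr; apply: S_lin.
move=> h Gh /=; move: u Su.
apply: (lspan_ind (S := [set u | S (smul u h)])) => /=.
- by rewrite smul0l.
- by move=> a v w Sv Sw; rewrite smulDl smulZl; apply: S_lin.
by move=> g Gg /=; apply: G_smul.
Qed.
Definition subLie_gen := SubLie S0 S_lin S_part S_smul.
End SubLieGen.

Definition Lop (K : fieldType) (V : superAlgebraType K) (x : V) : gl V := smul x.

HB.mixin Record isJordanSuperalgebra (K : fieldType) V of SuperAlgebra K V := {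
  jordanC : forall i j (x y : V), homog i x -> homog j y ->
    smul x y = (-1) ^+ (i && j) *: smul y x;
  jordanJ : forall i j k (x y z : V), homog i x -> homog j y -> homog k z ->
    (-1) ^+ (i && k) *: scomm (Lop x) (Lop (smul y z))
    + (-1) ^+ (j && i) *: scomm (Lop y) (Lop (smul z x))
    + (-1) ^+ (k && j) *: scomm (Lop z) (Lop (smul x y)) = 0
}.

#[short(type="jordanSuperalgebraType")]
HB.structure Definition JordanSuperalgebra (K : fieldType) :=
  {V of SuperAlgebra K V & isJordanSuperalgebra K V}.

Arguments smul_homog {K s i j x y} : rename.
Arguments jordanC {K s i j x y} : rename.
Arguments jordanJ {K s i j k x y z} : rename.

Section Jordan.
Variables (K : fieldType) (V : jordanSuperalgebraType K).
Implicit Types (x y z a : V) (D E : gl V) (P : gl V * gl V).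

Definition unital := exists e : V, forall x, smul e x = x /\ smul x e = x.

(* Homogeneous derivations, of parity i. *)
Definition derivation (i : bool) D :=
  homog i D /\ forall j x y, homog j x ->
    D (smul x y) = smul (D x) y + (-1) ^+ (j && i) *: smul x (D y).

Definition der_set : set (gl V) := lspan [set D | exists i, derivation i D].

Definition inn_set : set (gl V) :=
  lspan [set D | exists x y, D = scomm (Lop x) (Lop y)].

Definition str_set : set (gl V) :=
  [set A | exists x D, der_set D /\ A = Lop x + D].

Definition istr_set : set (gl V) :=
  [set A | exists x D, inn_set D /\ A = Lop x + D].

Definition Dop x y : gl V :=
  2 *: Lop (smul x y) + 2 *: scomm (Lop x) (Lop y).

Definition triple x y z : V := Dop x y z.

(* The identity for D^sigma, with D = D^sigma and E = D^(-sigma) of parity i. *)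
Definition triple_der (i : bool) D E :=
  forall j k l x y z, homog j x -> homog k y -> homog l z ->
    D (triple x y z) =
      triple (D x) y z
      + (-1) ^+ (j && i) *: triple x (E y) z
      + (-1) ^+ ((j (+) k) && i) *: triple x y (D z).

Definition der2_gen : set (gl V * gl V)%type :=
  [set P | exists i, [/\ homog i P.1, homog i P.2,
                         triple_der i P.1 P.2 & triple_der i P.2 P.1]].

Definition der2_set : set (gl V * gl V)%type := lspan der2_gen.

Definition inn2_gen : set (gl V * gl V)%type :=
  [set P | exists i j x y, [/\ homog i x, homog j y &
     P = (Dop x y, - ((-1) ^+ (i && j) *: Dop y x))]].

Definition inn2_set : set (gl V * gl V)%type := lspan inn2_gen.

Lemma LopE x y : Lop x y = smul x y. Proof. by []. Qed.

Fact Lop_linear : linear (@Lop K V).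
Proof. by move=> a x y; apply: glP => z; exact: smul_linearl. Qed.
HB.instance Definition _ := GRing.isLinear.Build K V (gl V) *:%R (@Lop K V)
  Lop_linear.

Lemma Lop_homog i x : homog i x -> homog i (Lop x).
Proof. by move=> hx; apply/homog_glP => j y hy; apply: smul_homog. Qed.

Lemma homog_app i j D x : homog i D -> homog j x -> homog (i (+) j) (D x).
Proof. by move=> /homog_glP hD; apply: hD. Qed.

Lemma scomm_Lop i j D x : derivation i D -> homog j x ->
  scomm D (Lop x) = Lop (D x).
Proof.
move=> [hD dD] hx; rewrite (scomm_homog hD (Lop_homog hx)); apply: glP => y.
rewrite glDE glNE glZE !gl_compE !LopE (dD _ _ _ hx) [j && i]andbC.
by zmodule.
Qed.

Lemma jordan_app i j k x y z w :
  homog i x -> homog j y -> homog k z ->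
    (-1) ^+ (i && k) *: (smul x (smul (smul y z) w)
      - (-1) ^+ (i && (j (+) k)) *: smul (smul y z) (smul x w))
    + (-1) ^+ (j && i) *: (smul y (smul (smul z x) w)
      - (-1) ^+ (j && (k (+) i)) *: smul (smul z x) (smul y w))
    + (-1) ^+ (k && j) *: (smul z (smul (smul x y) w)
      - (-1) ^+ (k && (i (+) j)) *: smul (smul x y) (smul z w)) = 0.
Proof.
move=> hx hy hz; have /(congr1 (fun A : gl V => A w)) := jordanJ hx hy hz.
rewrite (scomm_homog (Lop_homog hx) (Lop_homog (smul_homog hy hz))).
rewrite (scomm_homog (Lop_homog hy) (Lop_homog (smul_homog hz hx))).
by rewrite (scomm_homog (Lop_homog hz) (Lop_homog (smul_homog hx hy))).
Qed.

Lemma derivation_scomm_Lop i j x y : homog i x -> homog j y ->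
  derivation (i (+) j) (scomm (Lop x) (Lop y)).
Proof.
move=> hx hy; split; first by apply: scomm_homog_mul; apply: Lop_homog.
move=> k a b ha; rewrite (scomm_homog (Lop_homog hx) (Lop_homog hy)).
suff der l c : homog l c -> smul x (smul y (smul a c))
    - (-1) ^+ (i && j) *: smul y (smul x (smul a c)) =
    smul (smul x (smul y a) - (-1) ^+ (i && j) *: smul y (smul x a)) c
    + (-1) ^+ (k && (i (+) j)) *:
      smul a (smul x (smul y c) - (-1) ^+ (i && j) *: smul y (smul x c)).
  rewrite !(glDE, glNE, glZE, gl_compE, LopE) -(spart_sum b) !smulDr.
  have der0 := der _ _ (homog_part false b).
  have der1 := der _ _ (homog_part true b).
  move: der0 der1.
  rewrite !(smulDr, smulNr, smulZr, scalerDr, scalerN, opprD) => der0 der1.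
  apply: etrans (etrans (congr2 +%R der0 der1) _); zmodule.
move=> hc.
have J1 := jordan_app y ha hx hc.
have J2 := jordan_app x ha hy hc.
move: J1 J2.
rewrite (jordanC hy hx) (jordanC hx ha) (jordanC hy ha) (jordanC hc hx).
rewrite (jordanC hc hy) (jordanC hc ha).
have hxc := smul_homog hx hc; have hyc := smul_homog hy hc.
have hac := smul_homog ha hc; have hax := smul_homog ha hx.
have hay := smul_homog ha hy; have hxy := smul_homog hx hy.
rewrite !(smulDl, smulNl, smulZl, smulZr, smulDr, smulNr).
rewrite (jordanC hxc hy) (jordanC hyc hx) (jordanC hac hy) (jordanC hac hx).
rewrite (jordanC hax hy) (jordanC hay hx) (jordanC hyc hax) (jordanC hac hxy).
rewrite (jordanC hxc hay).
rewrite (jordanC (smul_homog hx hay) hc) (jordanC (smul_homog hy hax) hc).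
clear.
case: i j k l => [] [] [] [] /=;
  rewrite ?(expr0, expr1, scale1r, scaleN1r, opprK, smulNr) => J1 J2;
  apply/eqP; rewrite -subr_eq0; apply/eqP;
  first [ apply: etrans (etrans (congr2 (fun u v => u + v) J1 J2) (addr0 0)); zmodule
        | apply: etrans (etrans (congr2 (fun u v => u - v) J1 J2) (subr0 0)); zmodule
        | apply: etrans (etrans (congr2 (fun u v => - u + v) J1 J2) _);
          [zmodule | by rewrite oppr0 addr0]
        | apply: etrans (etrans (congr2 (fun u v => - u - v) J1 J2) _);
          [zmodule | by rewrite oppr0 addr0]].
Qed.
Lemma LopD x y : Lop (x + y) = Lop x + Lop y. Proof. exact: linearD. Qed.
Lemma LopN x : Lop (- x) = - Lop x. Proof. exact: linearN. Qed.
Lemma LopZ (c : K) x : Lop (c *: x) = c *: Lop x. Proof. exact: linearZ. Qed.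

Lemma scomm_derivation i j D E :
  derivation i D -> derivation j E -> derivation (i (+) j) (scomm D E).
Proof.
move=> [hD dD] [hE dE]; split; first exact: scomm_homog_mul.
move=> k x y hx; rewrite (scomm_homog hD hE) !(glDE, glNE, glZE, gl_compE).
rewrite (dD _ _ _ hx) (dE _ _ _ hx) !(gl_appD D, gl_appD E, gl_appZ _ D, gl_appZ _ E).
rewrite (dD _ _ _ hx) (dE _ _ _ hx).
rewrite (dD _ _ _ (homog_app hE hx)) (dE _ _ _ (homog_app hD hx)).
rewrite !(smulDl, smulNl, smulZl, smulZr, smulDr, smulNr).
case: i j k {hD dD hE dE hx} => [] [] [] /=;
  rewrite ?(expr0, expr1, scale1r, scaleN1r, opprK, opprD); zmodule.
Qed.

Definition str_gen : set (gl V) :=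
  [set A | (exists i x, homog i x /\ A = Lop x) \/ (exists i, derivation i A)].

Lemma Lop_lspan (G : set (gl V)) x :
  (forall i x, homog i x -> G (Lop x)) -> lspan G (Lop x).
Proof.
move=> GL; rewrite -(spart_sum x) (linearD (@Lop K V)).
by apply: lspanD; apply: lspan_gen; apply: GL (homog_part _ _).
Qed.

Lemma lspan_mono (W : lmodType K) (G H : set W) :
  G `<=` lspan H -> lspan G `<=` lspan H.
Proof.
move=> GH; apply: lspan_ind => //; first exact: lspan0.
by move=> a u v Su Sv; apply: lspanD => //; apply: lspanZ.
Qed.

Lemma scomm_Lop_span (G : set (gl V)) x y :
  (forall i j x y, homog i x -> homog j y -> G (scomm (Lop x) (Lop y))) ->
  lspan G (scomm (Lop x) (Lop y)).
Proof.
move=> GL; rewrite -(spart_sum x) -(spart_sum y) !(linearD (@Lop K V)) -!gl_smulE.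
rewrite !(smulDl, smulDr); do 2?apply: lspanD; apply: lspan_gen;
  exact: GL (homog_part _ _) (homog_part _ _).
Qed.

Lemma str_set_span : str_set = lspan str_gen.
Proof.
apply/seteqP; split=> [A [x [D [dD ->]]]|].
  apply: lspanD; first by apply: Lop_lspan => i z hz; left; exists i, z.
  by apply: lspan_mono dD => E dE; apply: lspan_gen; right.
apply: lspan_ind => [|a A B [x [D [dD ->]]] [y [E [dE ->]]]|A].
- by exists 0, 0; rewrite linear0 addr0; split=> //; apply: lspan0.
- exists (a *: x + y), (a *: D + E); split.
    by apply: lspanD => //; apply: lspanZ.
  by rewrite linearP /= scalerDr; zmodule.
move=> [[i [x [hx ->]]]|[i dA]].
  by exists x, 0; rewrite addr0; split=> //; apply: lspan0.
by exists 0, A; rewrite linear0 add0r; split=> //; apply: lspan_gen; exists i.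
Qed.

Lemma str_set_Lop x : str_set (Lop x).
Proof. by exists x, 0; rewrite addr0; split=> //; apply: lspan0. Qed.

Lemma str_set_der i D : derivation i D -> str_set D.
Proof.
move=> dD; exists 0, D; rewrite linear0 add0r; split=> //.
by apply: lspan_gen; exists i.
Qed.

Fact str_gen_homog A : str_gen A -> exists i, homog i A.
Proof.
move=> [[i [x [hx ->]]]|[i [hA _]]]; exists i => //; exact: Lop_homog.
Qed.

Fact str_gen_smul A B : str_gen A -> str_gen B -> str_set (smul A B).
Proof.
move=> [[i [x [hx ->]]]|[i dA]] [[j [y [hy ->]]]|[j dB]].
- exact: str_set_der (derivation_scomm_Lop hx hy).
- rewrite (lieC _ _ _ _ (Lop_homog hx) (proj1 dB)) gl_smulE (scomm_Lop dB hx).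
  by rewrite -linearZ -linearN; apply: str_set_Lop.
- by rewrite gl_smulE (scomm_Lop dA hy); apply: str_set_Lop.
- exact: str_set_der (scomm_derivation dA dB).
Qed.

Definition str : subLie (gl V) :=
  subLie_gen str_set_span str_gen_homog str_gen_smul.

Definition istr_gen : set (gl V) :=
  [set A | (exists i x, homog i x /\ A = Lop x) \/
     (exists i j x y, [/\ homog i x, homog j y & A = scomm (Lop x) (Lop y)])].

Lemma istr_set_span : istr_set = lspan istr_gen.
Proof.
apply/seteqP; split=> [A [x [D [dD ->]]]|].
  apply: lspanD; first by apply: Lop_lspan => i z hz; left; exists i, z.
  apply: lspan_mono dD => _ [y [z ->]]; apply: scomm_Lop_span.
  by move=> i j u v hu hv; right; exists i, j, u, v.
apply: lspan_ind => [|a A B [x [D [dD ->]]] [y [E [dE ->]]]|A].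
- by exists 0, 0; rewrite linear0 addr0; split=> //; apply: lspan0.
- exists (a *: x + y), (a *: D + E); split.
    by apply: lspanD => //; apply: lspanZ.
  by rewrite linearP /= scalerDr; zmodule.
move=> [[i [x [hx ->]]]|[i [j [x [y [hx hy ->]]]]]].
  by exists x, 0; rewrite addr0; split=> //; apply: lspan0.
exists 0, (scomm (Lop x) (Lop y)); rewrite linear0 add0r; split=> //.
by apply: lspan_gen; exists x, y.
Qed.

Lemma istr_set_Lop x : istr_set (Lop x).
Proof. by exists x, 0; rewrite addr0; split=> //; apply: lspan0. Qed.

Lemma istr_set_inn D : inn_set D -> istr_set D.
Proof. by move=> dD; exists 0, D; rewrite linear0 add0r. Qed.

Fact istr_gen_homog A : istr_gen A -> exists i, homog i A.
Proof.
move=> [[i [x [hx ->]]]|[i [j [x [y [hx hy ->]]]]]].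
  by exists i; apply: Lop_homog.
by exists (i (+) j); apply: scomm_homog_mul; apply: Lop_homog.
Qed.

Lemma inn_set_scomm x y : inn_set (scomm (Lop x) (Lop y)).
Proof. by apply: lspan_gen; exists x, y. Qed.

Lemma der_inn i D j x k y : derivation i D -> homog j x -> homog k y ->
  scomm D (scomm (Lop x) (Lop y)) =
  scomm (Lop (D x)) (Lop y) + (-1) ^+ (i && j) *: scomm (Lop x) (Lop (D y)).
Proof.
move=> dD hx hy; rewrite -!gl_smulE (lieJ _ _ _ _ _ (proj1 dD) (Lop_homog hx)).
by rewrite !gl_smulE (scomm_Lop dD hx) (scomm_Lop dD hy).
Qed.

Fact istr_gen_smul A B : istr_gen A -> istr_gen B -> istr_set (smul A B).
Proof.
move=> [[i [x [hx ->]]]|[i [j [x [y [hx hy ->]]]]]].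
  move=> [[k [z [hz ->]]]|[k [l [z [t [hz ht ->]]]]]].
    by apply/istr_set_inn/inn_set_scomm.
  have dB := derivation_scomm_Lop hz ht.
  rewrite (lieC _ _ _ _ (Lop_homog hx) (proj1 dB)) gl_smulE (scomm_Lop dB hx).
  by rewrite -linearZ -linearN; apply: istr_set_Lop.
have dA := derivation_scomm_Lop hx hy.
move=> [[k [z [hz ->]]]|[k [l [z [t [hz ht ->]]]]]].
  by rewrite gl_smulE (scomm_Lop dA hz); apply: istr_set_Lop.
rewrite gl_smulE (der_inn dA hz ht); apply: istr_set_inn.
by apply: lspanD; [|apply: lspanZ]; apply: inn_set_scomm.
Qed.

Definition istr : subLie (gl V) :=
  subLie_gen istr_set_span istr_gen_homog istr_gen_smul.

Lemma inn_sub_der : inn_set `<=` der_set.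
Proof.
apply: lspan_mono => _ [x [y ->]]; apply: scomm_Lop_span.
by move=> i j u v hu hv; exists (i (+) j); apply: derivation_scomm_Lop.
Qed.

Lemma Dop_homog i j x y : homog i x -> homog j y -> homog (i (+) j) (Dop x y).
Proof.
move=> hx hy; apply: homogD; apply: homogZ.
  exact: Lop_homog (smul_homog hx hy).
by apply: scomm_homog_mul; apply: Lop_homog.
Qed.

Lemma DopDl x y z : Dop (x + y) z = Dop x z + Dop y z.
Proof.
rewrite /Dop (smulDl x y z) !LopD -!gl_smulE (smulDl (Lop x)) !scalerDr.
by zmodule.
Qed.

Lemma DopDr x y z : Dop z (x + y) = Dop z x + Dop z y.
Proof.
rewrite /Dop (smulDr x y z) !LopD -!gl_smulE (smulDr (Lop x)) !scalerDr.
by zmodule.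
Qed.

Lemma DopZl (c : K) x y : Dop (c *: x) y = c *: Dop x y.
Proof.
rewrite /Dop (smulZl c x y) !LopZ -!gl_smulE (smulZl c (Lop x)).
by rewrite scalerDr !scalerA ![2 * _]mulrC.
Qed.

Lemma DopZr (c : K) x y : Dop y (c *: x) = c *: Dop y x.
Proof.
rewrite /Dop (smulZr c x y) !LopZ -!gl_smulE (smulZr c (Lop x)).
by rewrite scalerDr !scalerA ![2 * _]mulrC.
Qed.

Lemma DopNl x y : Dop (- x) y = - Dop x y.
Proof. by rewrite -scaleN1r DopZl scaleN1r. Qed.

Lemma DopNr x y : Dop x (- y) = - Dop x y.
Proof. by rewrite -scaleN1r DopZr scaleN1r. Qed.

Lemma scomm_app i j D E z : homog i D -> homog j E ->
  scomm D E z = D (E z) - (-1) ^+ (i && j) *: E (D z).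
Proof. by move=> hD hE; rewrite (scomm_homog hD hE). Qed.

Lemma triple_derP i D E : homog i D ->
  triple_der i D E <->
  (forall j k x y, homog j x -> homog k y ->
    scomm D (Dop x y) = Dop (D x) y + (-1) ^+ (j && i) *: Dop x (E y)).
Proof.
move=> hD; split=> [tD j k x y hx hy|tD j k l x y z hx hy hz].
  suff tDz l z : homog l z -> scomm D (Dop x y) z =
      (Dop (D x) y + (-1) ^+ (j && i) *: Dop x (E y)) z.
    apply: glP => z; rewrite -(spart_sum z) 2!gl_appD.
    by rewrite (tDz _ _ (homog_part false z)) (tDz _ _ (homog_part true z)).
  move=> hz; rewrite (scomm_app _ hD (Dop_homog hx hy)).
  rewrite [D _](tD _ _ _ _ _ _ hx hy hz) [i && (_ (+) _)]andbC /triple.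
  transitivity (Dop (D x) y z + (-1) ^+ (j && i) *: Dop x (E y) z) => //.
  by zmodule.
have tDz : scomm D (Dop x y) z =
    Dop (D x) y z + (-1) ^+ (j && i) *: Dop x (E y) z by rewrite (tD j k).
rewrite /triple -tDz (scomm_app _ hD (Dop_homog hx hy)) [i && (_ (+) _)]andbC.
by zmodule.
Qed.

Lemma scomm_Lop_Dop i j k a x y : homog i a -> homog j x -> homog k y ->
  scomm (Lop a) (Dop x y) =
  Dop (smul a x) y - (-1) ^+ (j && i) *: Dop x (smul a y).
Proof.
move=> ha hx hy.
have La := Lop_homog ha; have Lx := Lop_homog hx; have Ly := Lop_homog hy.
have hax := smul_homog ha hx; have hay := smul_homog ha hy.
have hxy := smul_homog hx hy.
have dxy := derivation_scomm_Lop hx hy.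
suff: scomm (Lop a) (Lop (smul x y)) + scomm (Lop a) (scomm (Lop x) (Lop y)) =
    Lop (smul (smul a x) y) + scomm (Lop (smul a x)) (Lop y)
    - (-1) ^+ (j && i) *:
      (Lop (smul x (smul a y)) + scomm (Lop x) (Lop (smul a y))).
  move=> eqL; rewrite /Dop -!scalerDr -gl_smulE smulZr smulDr !gl_smulE eqL.
  by rewrite scalerBr !scalerA [2 * _]mulrC.
rewrite -[scomm _ (scomm _ _)]gl_smulE (lieC _ _ _ _ La (proj1 dxy)).
rewrite gl_smulE (scomm_Lop dxy ha) (scomm_homog Lx Ly).
rewrite glDE glNE glZE !gl_compE !LopE.
have := jordanJ ha hx hy.
rewrite (jordanC hy ha) -[scomm (Lop y) _]gl_smulE.
rewrite (lieC _ _ _ _ Ly (Lop_homog hax)) (jordanC hax hy).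
rewrite (jordanC hx ha).
rewrite -!gl_smulE !(smulZr, smulNr, LopD, LopN, LopZ).
clear; case: i j k => [] [] [] /=;
  rewrite ?(expr0, expr1, scale1r, scaleN1r, opprK) => J;
  apply/eqP; rewrite -subr_eq0; apply/eqP;
  first [ apply: etrans J; zmodule
        | apply: etrans (etrans (congr1 -%R J) (oppr0 _)); zmodule ].
Qed.
Fact der2_gen_homog P : der2_gen P -> exists i, homog i P.
Proof. by move=> [i [h1 h2 _ _]]; exists i; apply/homog_prod. Qed.

Lemma triple_der_scomm i j D E D' E' :
  homog i D -> homog i E -> homog j D' -> homog j E' ->
  triple_der i D E -> triple_der i E D ->
  triple_der j D' E' -> triple_der j E' D' ->
  triple_der (i (+) j) (scomm D D') (scomm E E').
Proof.
move=> hD hE hD' hE' /(triple_derP _ hD) tD /(triple_derP _ hE) tE.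
move=> /(triple_derP _ hD') tD' /(triple_derP _ hE') tE'.
apply/(triple_derP _ (scomm_homog_mul hD hD')) => k l x y hx hy.
have hDx := homog_app hD hx; have hDx' := homog_app hD' hx.
have hEy := homog_app hE hy; have hEy' := homog_app hE' hy.
have jac : scomm (scomm D D') (Dop x y) =
    scomm D (scomm D' (Dop x y))
    - (-1) ^+ (i && j) *: scomm D' (scomm D (Dop x y)).
  by rewrite -!gl_smulE (lieJ _ _ _ _ (Dop x y) hD hD'); zmodule.
rewrite jac (tD' _ _ _ _ hx hy) (tD _ _ _ _ hx hy).
have scommDZ (A B C : gl V) (c : K) :
    scomm A (B + c *: C) = scomm A B + c *: scomm A C.
  by rewrite -!gl_smulE smulDr smulZr.
rewrite (scommDZ D (Dop (D' x) y)) (scommDZ D' (Dop (D x) y)).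
rewrite (tD _ _ _ _ hDx' hy) (tD _ _ _ _ hx hEy').
rewrite (tD' _ _ _ _ hDx hy) (tD' _ _ _ _ hx hEy).
rewrite (scomm_app _ hD hD') (scomm_app _ hE hE').
rewrite {jac tD tE tD' tE'}.
case: i j k {hD hE hD' hE' hx hy hDx hDx' hEy hEy'} => [] [] [] /=;
  rewrite ?(expr0, expr1, scale1r, scaleN1r, opprK);
  rewrite !(DopDl, DopDr, DopNl, DopNr); zmodule.
Qed.

Fact der2_gen_smul P Q : der2_gen P -> der2_gen Q -> der2_set (smul P Q).
Proof.
move=> [i [hD hE tD tE]] [j [hD' hE' tD' tE']]; apply: lspan_gen.
exists (i (+) j); split; first exact: smul_homog; first exact: smul_homog.
  exact: triple_der_scomm.
exact: triple_der_scomm.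
Qed.

Definition der2 : subLie (gl V * gl V)%type :=
  subLie_gen (erefl der2_set) der2_gen_homog der2_gen_smul.

Fact inn2_gen_homog P : inn2_gen P -> exists i, homog i P.
Proof.
move=> [i [j [x [y [hx hy ->]]]]]; exists (i (+) j); apply/homog_prod.
split=> /=; first exact: Dop_homog.
by apply/homogN/homogZ; rewrite addbC; apply: Dop_homog.
Qed.

Lemma triple_der_Lop i a : homog i a -> triple_der i (Lop a) (- Lop a).
Proof.
move=> ha; apply/(triple_derP _ (Lop_homog ha)) => j k x y hx hy.
by rewrite (scomm_Lop_Dop ha hx hy) glNE !LopE DopNr scalerN.
Qed.

Lemma triple_der_opp i D E :
  homog i D -> triple_der i D E -> triple_der i (- D) (- E).
Proof.
move=> hD /(triple_derP _ hD) tD; apply/(triple_derP _ (homogN hD)).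
move=> j k x y hx hy; rewrite -gl_smulE smulNl gl_smulE (tD _ _ _ _ hx hy).
by rewrite !glNE DopNl DopNr scalerN opprD.
Qed.

Lemma triple_der_der i D : derivation i D -> triple_der i D D.
Proof.
move=> dD; have hD := proj1 dD; apply/(triple_derP _ hD) => j k x y hx hy.
rewrite /Dop -!gl_smulE smulDr !smulZr !gl_smulE (der_inn dD hx hy).
rewrite (scomm_Lop dD (smul_homog hx hy)) (proj2 dD _ _ _ hx) LopD LopZ.
by rewrite [i && j]andbC !scalerDr !scalerA ![2 * _]mulrC; zmodule.
Qed.

Lemma der2_gen_Lop i a : homog i a -> der2_gen (Lop a, - Lop a).
Proof.
move=> ha; have La := Lop_homog ha; have ta := triple_der_Lop ha.
exists i; split=> //=; first exact: homogN.
by rewrite -{2}[Lop a]opprK; apply: triple_der_opp.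
Qed.

Lemma der2_gen_der i D : derivation i D -> der2_gen (D, D).
Proof.
by move=> dD; exists i; split=> /=; try exact: (proj1 dD); apply: triple_der_der.
Qed.

Lemma inn2_genE i j x y : homog i x -> homog j y ->
  (Dop x y, - ((-1) ^+ (i && j) *: Dop y x)) =
  2 *: (Lop (smul x y), - Lop (smul x y))
  + 2 *: (scomm (Lop x) (Lop y), scomm (Lop x) (Lop y)) :> gl V * gl V.
Proof.
move=> hx hy; congr pair; rewrite /= /Dop (jordanC hy hx) LopZ -!gl_smulE.
rewrite (lieC _ _ _ _ (Lop_homog hy) (Lop_homog hx)) [j && i]andbC.
rewrite scalerDr !scalerN !scalerA opprD opprK [_ * 2 * _]mulrAC.
by rewrite -signr_addb addbb expr0 mul1r.
Qed.

Lemma inn2_sub_der2 : inn2_set `<=` der2_set.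
Proof.
apply: lspan_mono => _ [i [j [x [y [hx hy ->]]]]]; rewrite (inn2_genE hx hy).
apply: lspanD; apply: lspanZ; apply: lspan_gen.
  exact: der2_gen_Lop (smul_homog hx hy).
exact: der2_gen_der (derivation_scomm_Lop hx hy).
Qed.

Lemma der2_inn2_smul P Q : der2_gen P -> inn2_gen Q -> inn2_set (smul P Q).
Proof.
case: P => D E [i /= [hD hE /(triple_derP _ hD) tD /(triple_derP _ hE) tE]].
move=> [j [k [x [y [hx hy ->]]]]].
have hDx := homog_app hD hx; have hEy := homog_app hE hy.
suff ->: smul (D, E) (Dop x y, - ((-1) ^+ (j && k) *: Dop y x)) =
    (Dop (D x) y, - ((-1) ^+ ((i (+) j) && k) *: Dop y (D x)))
    + (-1) ^+ (j && i) *: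
      (Dop x (E y), - ((-1) ^+ (j && (i (+) k)) *: Dop (E y) x)).
  apply: lspanD; [|apply: lspanZ]; apply: lspan_gen.
    by exists (i (+) j), k, (D x), y.
  by exists j, (i (+) k), x, (E y).
congr pair; first exact: tD hx hy.
rewrite /= smulNr smulZr gl_smulE (tE _ _ _ _ hy hx).
case: i j k {hD hE tD tE hx hy hDx hEy} => [] [] [] /=;
  rewrite ?(expr0, expr1, scale1r, scaleN1r, opprK); zmodule.
Qed.

Fact inn2_gen_smul P Q : inn2_gen P -> inn2_gen Q -> inn2_set (smul P Q).
Proof.
move=> [i [j [x [y [hx hy ->]]]]] iQ; rewrite (inn2_genE hx hy).
rewrite smulDl !smulZl; apply: lspanD; apply: lspanZ; apply: der2_inn2_smul => //.
  exact: der2_gen_Lop (smul_homog hx hy).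
exact: der2_gen_der (derivation_scomm_Lop hx hy).
Qed.

Definition inn2 : subLie (gl V * gl V)%type :=
  subLie_gen (erefl inn2_set) inn2_gen_homog inn2_gen_smul.
End Jordan.

(* Main.v *)
Require Import Defs.
From HB Require Import structures.
From mathcomp Require Import all_boot all_algebra.
From mathcomp Require Import boolp classical_sets.

Set Implicit Arguments.
Unset Strict Implicit.
Unset Printing Implicit Defensive.

Import GRing.Theory.
Local Open Scope ring_scope.

(** Both isomorphisms are inverse to the first projection (D^+, D^-) |-> D^+.
    Let e be the unit, which is even.  Since D_{x,e} = D_{e,x} = 2 L_x, taking
    x or y to be e in the identity
      [D^+, D_{x,y}] = D_{D^+ x, y} + (-1)^(|x||D^-|) D_{x, D^- y}
    shows, when D^+ e = 0, that D^- e = 0 and then that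
    [D^+, L_x] = L_{D^+ x} = L_{D^- x} for all x, as 2 is invertible: so
    D^+ = D^- is a derivation.
    In general, (D^+, D^-) becomes such a pair after subtracting (L_a, - L_a)
    with a = D^+ e, whence D^+ is in str(V) and D^- = D^+ - 2 L_a
    ([der2_gen_unit]).  So the first projection maps Der(V,V) to str(V), and it
    is injective there because D^- is determined by D^+ ([der2_set_snd]).  It is
    onto because (L_a, - L_a) and (D, D), for D a derivation, lie in Der(V,V).

    For the second isomorphism, D_{x,y} is visibly in istr(V), and conversely
    (L_a, - L_a) is half of the generator of Inn(V,V) given by (a, e), from which
    ([L_x, L_y], [L_x, L_y]) is obtained by means of (x, y). *)

(** The isomorphism is stated in the direction opposite to [g]: the inverse of
    an even, bracket-preserving bijection between subalgebras is again one. *)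
Lemma subLie_isomorphic (K : fieldType) (L M : lieSuperalgebraType K)
    (S : subLie L) (T : subLie M) (g : {linear M -> L}) :
  (forall i v, homog i v -> homog i (g v)) ->
  (forall v w, g (smul v w) = smul (g v) (g w)) ->
  (forall v, sl_set T v -> sl_set S (g v)) ->
  (forall v, sl_set T v -> g v = 0 -> v = 0) ->
  (forall x, sl_set S x -> exists2 v, sl_set T v & g v = x) ->
  lie_isomorphic S T.
Proof.
move=> g_homog gM gT g_inj gS.
have g_injT (v w : sl_type T) : g (slval v) = g (slval w) -> v = w.
  move=> eq_vw; apply/eqP; rewrite -subr_eq0; apply/eqP/val_inj/g_inj.
    exact: set_mem (slvalP (v - w)).
  by rewrite /= linearB eq_vw subrr.
have f_sig (x : sl_type S) : {v : sl_type T | g (slval v) = slval x}.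
  have [v Tv <-] := cid2 (gS _ (set_mem (slvalP x))).
  by exists (SlType (mem_set Tv)).
pose f x := sval (f_sig x).
have gf x : g (slval (f x)) = slval x := svalP (f_sig x).
have f_linear : linear f.
  by move=> a x y; apply: g_injT; rewrite /= linearP /= !gf.
pose F : {linear sl_type S -> sl_type T} :=
  HB.pack f (GRing.isLinear.Build K _ _ *:%R f f_linear).
have g_part i v : g (spart i v) = spart i (g v).
  rewrite -{2}(spart_sum v) !linearD /= !(spart_homog _ (g_homog _ _ (homog_part _ _))).
  by case: i; rewrite /= ?addr0 ?add0r.
exists F; split=> [|i x hx|x y].
- pose h (v : sl_type T) : sl_type S := SlType (mem_set (gT _ (set_mem (slvalP v)))).
  exists h => [x|v]; last by apply: g_injT; rewrite [LHS]gf.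
  by apply: val_inj; rewrite /= [LHS]gf.
- apply: g_injT; rewrite [LHS]/= [LHS]g_part [in LHS]gf [RHS]gf.
  exact/homog_slval.
- by apply: g_injT; rewrite [LHS]gf [RHS]gM !gf.
Qed.

Section UnitalJordan.
Local Open Scope classical_set_scope.
Variables (K : fieldType) (V : jordanSuperalgebraType K) (e : V).
Hypothesis unit_e : forall x : V, smul e x = x /\ smul x e = x.
Hypothesis two_neq0 : (2 : K) != 0.
Implicit Types (x y a : V) (D E : gl V) (P : gl V * gl V).

Lemma smul1e x : smul e x = x. Proof. exact: (unit_e x).1. Qed.
Lemma smule1 x : smul x e = x. Proof. exact: (unit_e x).2. Qed.

Lemma scale2_inj (W : lmodType K) : injective ( *:%R 2 : W -> W).
Proof. exact: (scalerI two_neq0). Qed.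

Lemma unit_even : homog false e.
Proof.
have h0 := homog_part false e; have h1 := homog_part true e.
(* The odd parts of e_1 = e_1 e and of e_0 = e e_0 give e_1 = e_1 e_0 = 0. *)
have e10 : smul (spart true e) (spart false e) = spart true e.
  have /(congr1 (spart true)) := smule1 (spart true e).
  rewrite -{2}(spart_sum e) smulDr linearD /= (spart_homog _ (smul_homog h1 h0)).
  by rewrite (spart_homog _ (smul_homog h1 h1)) spartE /= addr0.
have e10_0 : smul (spart true e) (spart false e) = 0.
  have /(congr1 (spart true)) := smul1e (spart false e).
  rewrite -{1}(spart_sum e) smulDl linearD /= (spart_homog _ (smul_homog h0 h0)).
  by rewrite (spart_homog _ (smul_homog h1 h0)) spartE /= add0r.
by rewrite /homog -[RHS]spart_sum -e10 e10_0 addr0.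
Qed.

Lemma scomm_unit A i : homog i A -> scomm A (Lop e) = 0.
Proof.
move=> hA; rewrite (scomm_homog hA (Lop_homog unit_even)) andbF expr0 scale1r.
by apply: glP => x; rewrite glDE glNE !gl_compE !LopE !smul1e subrr.
Qed.

Lemma Dop_unitr i x : homog i x -> Dop x e = 2 *: Lop x.
Proof.
by move=> hx; rewrite /Dop smule1 (scomm_unit (Lop_homog hx)) scaler0 addr0.
Qed.

Lemma Dop_unitl i x : homog i x -> Dop e x = 2 *: Lop x.
Proof.
move=> hx; rewrite /Dop smul1e -gl_smulE.
rewrite (lieC _ _ _ _ (Lop_homog unit_even) (Lop_homog hx)) gl_smulE.
by rewrite (scomm_unit (Lop_homog hx)) scaler0 oppr0 scaler0 addr0.
Qed.

Lemma Lop_inj : injective (@Lop K V).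
Proof. by move=> x y /(congr1 (fun A : gl V => A e)); rewrite !LopE !smule1. Qed.

Lemma triple_derD i D E D' E' : homog i D -> homog i D' ->
  triple_der i D E -> triple_der i D' E' -> triple_der i (D + D') (E + E').
Proof.
move=> hD hD' /(triple_derP _ hD) tD /(triple_derP _ hD') tD'.
apply/(triple_derP _ (homogD hD hD')) => j k x y hx hy.
rewrite -gl_smulE smulDl !gl_smulE (tD _ _ _ _ hx hy) (tD' _ _ _ _ hx hy).
by rewrite !glDE DopDl DopDr (scalerDr _ (Dop x (E y))) addrACA.
Qed.

(** The identity for D^+ alone, without that for D^-, already forces this. *)
Lemma triple_der_unit0 i D E : homog i D -> homog i E -> triple_der i D E ->
  D e = 0 -> derivation i D /\ E = D.
Proof.
move=> hD hE /(triple_derP _ hD) tD De0.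
have Ee0 : E e = 0.
  have := tD _ _ _ _ unit_even unit_even; have hEe := homog_app hE unit_even.
  rewrite (Dop_unitl unit_even) (Dop_unitl hEe) De0 -{1}(scale0r (0 : V)) DopZl scale0r.
  rewrite add0r andFb expr0 scale1r -gl_smulE smulZr gl_smulE (scomm_unit hD).
  by move=> /scale2_inj; rewrite -(linear0 (@Lop K V)) => /Lop_inj.
have DLx j x : homog j x -> scomm D (Lop x) = Lop (D x).
  move=> hx; have := tD _ _ _ _ hx unit_even.
  rewrite (Dop_unitr hx) (Dop_unitr (homog_app hD hx)) Ee0.
  rewrite -{1}(scale0r (0 : V)) DopZr scale0r scaler0 addr0.
  by rewrite -gl_smulE smulZr => /scale2_inj.
have DLy j y : homog j y -> scomm D (Lop y) = Lop (E y).
  move=> hy; have := tD _ _ _ _ unit_even hy.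
  rewrite (Dop_unitl hy) (Dop_unitl (homog_app hE hy)) De0.
  rewrite -{1}(scale0r (0 : V)) DopZl scale0r add0r andFb expr0 scale1r.
  by rewrite -gl_smulE smulZr => /scale2_inj.
split.
  split=> // j x y hx; have /(congr1 (fun A : gl V => A y)) := DLx _ _ hx.
  rewrite (scomm_homog hD (Lop_homog hx)) glDE glNE glZE !gl_compE !LopE.
  by rewrite andbC => <-; rewrite addrNK.
apply: glP => x; rewrite -(spart_sum x) !gl_appD.
by congr (_ + _); apply: Lop_inj; rewrite -(DLx _ _ (homog_part _ _));
  rewrite -(DLy _ _ (homog_part _ _)).
Qed.

Lemma der2_gen_unit P : der2_gen P -> exists i,
  derivation i (P.1 - Lop (P.1 e)) /\ P.2 = P.1 - 2 *: Lop (P.1 e).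
Proof.
case: P => D E [i /= [hD hE tD _]]; exists i.
have ha : homog i (D e) by have := homog_app hD unit_even; rewrite addbF.
have La := Lop_homog ha.
(* Subtracting (L_a, - L_a), a = D e, reduces to a pair with D e = 0. *)
have t : triple_der i (D - Lop (D e)) (E + Lop (D e)).
  apply: triple_derD => //; first exact: homogN.
  by rewrite -[Lop _ in X in triple_der _ _ X]opprK;
    apply: triple_der_opp => //; apply: triple_der_Lop.
have [//| | |der eqE] := triple_der_unit0 _ _ t.
- by apply: homogD => //; apply: homogN.
- exact: homogD.
- by rewrite glDE glNE LopE smule1 subrr.
split=> //; apply: (addIr (Lop (D e))).
by rewrite eqE scaler_nat mulr2n opprD addrA addrNK.
Qed.

Lemma der2_set_snd P : der2_set P -> P.2 = P.1 - 2 *: Lop (P.1 e).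
Proof.
move: P; refine (lspan_ind
  (S := [set P : gl V * gl V | P.2 = P.1 - 2 *: Lop (P.1 e)]) _ _ _) => /=.
- by rewrite -[RHS]/(0 - 2 *: Lop (0 : V)) linear0 scaler0 subr0.
- move=> a [D E] [D' E'] /= -> ->.
  rewrite -[RHS]/(a *: D + D' - 2 *: Lop (a *: D e + D' e)) LopD LopZ.
  rewrite !scalerDr !scalerN !scalerA [a * 2]mulrC.
  by zmodule.
by move=> P /der2_gen_unit[i []].
Qed.

Lemma der2_set_fst P : der2_set P -> str_set P.1.
Proof.
move: P; refine (lspan_ind
  (S := [set P : gl V * gl V | str_set P.1]) _ _ _) => /=.
- by rewrite -[0](linear0 (@Lop K V)); apply: str_set_Lop.
- by move=> a P Q; apply: (sl_lin (s := str V)).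
move=> P /der2_gen_unit[i [der _]]; exists (P.1 e), (P.1 - Lop (P.1 e)).
by split; [apply: lspan_gen; exists i|rewrite addrC addrNK].
Qed.

Lemma str_set_lift A : str_set A -> exists2 P, @der2_set K V P & P.1 = A.
Proof.
rewrite str_set_span; move: A.
refine (lspan_ind
  (S := [set A : gl V | exists2 P, @der2_set K V P & P.1 = A]) _ _ _) => /=.
- by exists 0 => //; apply: lspan0.
- move=> a A' B [P dP <-] [Q dQ <-]; exists (a *: P + Q) => //.
  by apply: lspanD => //; apply: lspanZ.
move=> A' [[i [x [hx ->]]]|[i dA]] /=.
  by exists (Lop x, - Lop x) => //; apply/lspan_gen/(der2_gen_Lop hx).
by exists (A', A') => //; apply/lspan_gen/(der2_gen_der dA).
Qed.

Lemma inn2_set_fst P : inn2_set P -> istr_set P.1.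
Proof.
move: P; refine (lspan_ind
  (S := [set P : gl V * gl V | istr_set P.1]) _ _ _) => /=.
- by rewrite -[0](linear0 (@Lop K V)); apply: istr_set_Lop.
- by move=> a P Q; apply: (sl_lin (s := istr V)).
move=> P [i [j [x [y [hx hy ->]]]]]; rewrite /= /Dop -LopZ.
exists (2 *: smul x y), (2 *: scomm (Lop x) (Lop y)); split=> //.
exact/lspanZ/inn_set_scomm.
Qed.

Lemma inn2_set_Lop i a : homog i a -> inn2_set (Lop a, - Lop a).
Proof.
move=> ha; rewrite -[(_, _)]scale1r -(mulVf two_neq0) -scalerA.
apply/lspanZ/lspan_gen; exists i, false, a, e; split=> //.
  exact: unit_even.
by rewrite (Dop_unitr ha) (Dop_unitl ha) andbF expr0 scale1r -scalerN.
Qed.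

Lemma inn2_set_scomm i j x y : homog i x -> homog j y ->
  inn2_set (scomm (Lop x) (Lop y), scomm (Lop x) (Lop y)).
Proof.
move=> hx hy; rewrite -[(_, _)]scale1r -(mulVf two_neq0) -scalerA.
apply: lspanZ; move: (inn2_genE hx hy) => /esym/(canRL (addKr _)) ->.
apply: lspanD; last by apply: lspan_gen; exists i, j, x, y.
rewrite -scaleN1r; apply/lspanZ/lspanZ.
exact: inn2_set_Lop (smul_homog hx hy).
Qed.

Lemma istr_set_lift A : istr_set A -> exists2 P, @inn2_set K V P & P.1 = A.
Proof.
rewrite istr_set_span; move: A.
refine (lspan_ind
  (S := [set A : gl V | exists2 P, @inn2_set K V P & P.1 = A]) _ _ _) => /=.
- by exists 0 => //; apply: lspan0.
- move=> a A' B [P dP <-] [Q dQ <-]; exists (a *: P + Q) => //.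
  by apply: lspanD => //; apply: lspanZ.
move=> _ [[i [x [hx ->]]]|[i [j [x [y [hx hy ->]]]]]] /=.
  by exists (Lop x, - Lop x) => //; apply: inn2_set_Lop hx.
by eexists; first exact: inn2_set_scomm hx hy.
Qed.

Lemma der2_fst_eq0 P : der2_set P -> P.1 = 0 -> P = 0.
Proof.
case: P => D E /der2_set_snd /= -> ->.
by rewrite gl0E linear0 scaler0 subr0.
Qed.

End UnitalJordan.

Theorem proposition3p7 (K : fieldType)
    (hK2 : 2%N \notin [pchar K]) (hK3 : 3%N \notin [pchar K])
    (V : jordanSuperalgebraType K) (hV : unital V) :
  lie_isomorphic (str V) (der2 V) /\ lie_isomorphic (istr V) (inn2 V).
Proof.
have [e unit_e] := hV.
have two_neq0 : (2 : K) != 0 by move: hK2; rewrite inE.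
pose g : {linear (gl V * gl V)%type -> gl V} := fst.
have g_homog i v : homog i v -> homog i (g v) by case/homog_prod.
split; apply: (@subLie_isomorphic _ _ _ _ _ g) => //.
- exact: der2_set_fst.
- exact: der2_fst_eq0.
- exact: str_set_lift.
- exact: inn2_set_fst.
- by move=> v /inn2_sub_der2; apply: der2_fst_eq0.
- exact: istr_set_lift.
Qed.
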